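(* Let $n\ge m\ge 1$ and $k\ge 0$ be integers. There is a bijection $$f:\mathrm{RInc}_k((n,m))\to \mathrm{SYT}\big((n-k+1,\,m-k+1,\,1^k)/(1^2)\big)$$ such that $\mathrm{maj}(f(T))=\mathrm{maj}(T)$ for every $T\in \mathrm{RInc}_k((n,m))$.
   Context: Tableaux are drawn in English notation (row 1 on top). A row-increasing tableau of skew shape $\lambda/\mu$ is a filling of the boxes of $\lambda/\mu$ by positive integers that is strictly increasing along rows (left to right) and weakly increasing down columns, and whose set of entries is an initial segment $\{1,2,\dots,N\}$ of the positive integers. $\mathrm{RInc}_k(\lambda/\mu)$ is the set of row-increasing tableaux of shape $\lambda/\mu$ with maximal entry $|\lambda/\mu|-k$ (and $\mathrm{RInc}_k(\lambda)$ is the case $\mu=\emptyset$). $\mathrm{SYT}(\lambda/\mu)$ is the set of standard Young tableaux of skew shape $\lambda/\mu$ (entries $1,\dots,|\lambda/\mu|$ each used once, increasing along rows and down columns). Exponents in shapes denote repeated parts: $(a,b,1^k)$ is $(a,b,1,\dots,1)$ with $k$ ones, and $(1^2)=(1,1)$. If the indicated sequence is not a partition, or does not contain the inner shape, the set of tableaux is empty. A descent of a tableau $T$ is an integer $i$ such that some occurrence of $i$ in $T$ lies in a row strictly above the row of some occurrence of $i+1$; $\mathrm{maj}(T)$ is the sum of all descents of $T$ (each counted once). *)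

(* Defs.v *)
From mathcomp Require Import all_boot.

Set Implicit Arguments.
Unset Strict Implicit.
Unset Printing Implicit Defensive.

(* Rows and columns are numbered from 0; row 0 is the top row. *)

Definition is_partition (la : seq nat) : bool :=
  sorted geq la && (0 \notin la).

Definition is_skew_shape (la mu : seq nat) : bool :=
  [&& is_partition la, is_partition mu &
      all (fun i => nth 0 mu i <= nth 0 la i) (iota 0 (size mu))].

Definition boxes (la mu : seq nat) : seq (nat * nat) :=
  [seq (i, j) | i <- iota 0 (size la),
                j <- iota (nth 0 mu i) (nth 0 la i - nth 0 mu i)].

Definition box (la mu : seq nat) : finType := seq_sub (boxes la mu).

Definition box_row la mu (b : box la mu) : nat := (ssval b).1.
Definition box_col la mu (b : box la mu) : nat := (ssval b).2.

Definition filling (la mu : seq nat) : Type := {ffun box la mu -> nat}.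

Section Fillings.

Variables la mu : seq nat.
Implicit Types (T : filling la mu) (b c : box la mu).

(* Equal to 0 when there are no boxes. *)
Definition max_entry T : nat := \max_b T b.

Definition row_strict T : bool :=
  [forall b, forall c,
     (box_row b == box_row c) && (box_col b < box_col c) ==> (T b < T c)].

Definition col_weak T : bool :=
  [forall b, forall c,
     (box_col b == box_col c) && (box_row b < box_row c) ==> (T b <= T c)].

Definition col_strict T : bool :=
  [forall b, forall c,
     (box_col b == box_col c) && (box_row b < box_row c) ==> (T b < T c)].

Definition entries_initial T : bool :=
  [forall b, 0 < T b] && all (fun v => v \in codom T) (iota 1 (max_entry T)).

Definition row_increasing T : bool :=
  [&& row_strict T, col_weak T & entries_initial T].

(* The condition on the maximal entry is additive, so that it fails when
   k exceeds the number of boxes. *)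
Definition is_RInc (k : nat) T : bool :=
  [&& is_skew_shape la mu, row_increasing T &
      max_entry T + k == size (boxes la mu)].

Definition is_SYT T : bool :=
  [&& is_skew_shape la mu, row_strict T, col_strict T &
      perm_eq (codom T) (iota 1 (size (boxes la mu)))].

Definition is_descent T (i : nat) : bool :=
  [exists b, exists c,
     [&& T b == i, T c == i.+1 & box_row b < box_row c]].

(* A descent i satisfies i.+1 <= max_entry T, so the sum runs over all of them. *)
Definition maj T : nat := \sum_(i < max_entry T | is_descent T i) i.

End Fillings.

Definition RInc (k : nat) (la mu : seq nat) : Type :=
  {T : filling la mu | is_RInc k T}.

Definition SYT (la mu : seq nat) : Type :=
  {T : filling la mu | is_SYT T}.

(* The sequence (n - k + 1, m - k + 1, 1^k). Truncation in [m.+1 - k] is harmless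
   when m >= 1: for k > m it produces a part 0 followed by k >= 1 parts 1, which is
   not a partition, just like the sequence of integers. ([m - k + 1] with
   truncated subtraction would instead produce a part 1.) *)
Definition outer_shape (n m k : nat) : seq nat :=
  [:: n.+1 - k, m.+1 - k & nseq k 1].

(* Main.v *)
(** A two-row row-increasing tableau is a word whose i-th letter tells whether i
    occurs in row 1 only (A), in row 2 only (B) or in both rows (D); weakly
    increasing columns say that every prefix has at least as many A's as B's.
    A standard tableau of the skew shape is a word over the same letters under
    the same condition, where D now marks the entries of the first column, whose
    boxes share neither row nor column with the others. The two encodings
    only disagree on descents inside a maximal run of letters B and D: there i is
    a descent of the row-increasing tableau iff letter i is D, and of the standard
    tableau iff letter i+1 is D. Rotating each maximal run by one
    step, its last letter becoming the first, thus carries one descent set to the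
    other. It preserves the ballot condition, which only needs
    to be tested at the ends of runs. *)

Require Import Defs.
From mathcomp Require Import all_boot zify.

Set Implicit Arguments.
Unset Strict Implicit.
Unset Printing Implicit Defensive.

(** * Words and rotation of runs *)

(* The letters A, B and D of the introduction. *)
Notation letter := (option bool).
Notation upper := (@Some bool true).
Notation lower := (@Some bool false).
Notation both := (@None bool).

Implicit Types (r s w : seq letter) (x y : letter).

(* Applies [h] to each maximal run of letters other than [upper]; [r] accumulates
   the current run. *)
Fixpoint runmap (h : seq letter -> seq letter) r w :=
  match w with
  | [::] => h r
  | Some true :: w' => h r ++ upper :: runmap h [::] w'
  | x :: w' => runmap h (rcons r x) w'
  end.

Definition is_run r := upper \notin r.

Lemma is_run_cons x r : is_run (x :: r) = (x != upper) && is_run r.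
Proof. by rewrite /is_run inE negb_or eq_sym. Qed.

Lemma is_run_rcons r x : is_run (rcons r x) = (x != upper) && is_run r.
Proof. by rewrite /is_run mem_rcons inE negb_or eq_sym. Qed.

Lemma runmap_run h r s : is_run s -> runmap h r s = h (r ++ s).
Proof.
elim: s r => [|x s IH] r; first by rewrite cats0.
rewrite is_run_cons => /andP[xA sA].
by case: x xA => [[]|] //= _; rewrite IH // cat_rcons.
Qed.

Lemma runmap_cat h r s w : is_run s ->
  runmap h r (s ++ upper :: w) = h (r ++ s) ++ upper :: runmap h [::] w.
Proof.
elim: s r => [|x s IH] r; first by rewrite cats0.
rewrite is_run_cons => /andP[xA sA].
by case: x xA => [[]|] //= _; rewrite IH // cat_rcons.
Qed.

(** Induction along the recursion of [runmap], with the invariant that the accumulator [r] is a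
    run. *)
Lemma run_ind (P : seq letter -> seq letter -> Prop) :
    (forall r, is_run r -> P r [::]) ->
    (forall r w, is_run r -> P [::] w -> P r (upper :: w)) ->
    (forall r x w, x != upper -> is_run r -> P (rcons r x) w -> P r (x :: w)) ->
  forall r w, is_run r -> P r w.
Proof.
move=> P0 PA Px r w; elim: w r => [|x w IH] r rA; first exact: P0.
have [->|xA] := eqVneq x upper; first by apply: PA => //; exact: IH.
by apply: Px => //; apply: IH; rewrite is_run_rcons xA.
Qed.

Lemma runmap_cons h r x w : x != upper ->
  runmap h r (x :: w) = runmap h (rcons r x) w.
Proof. by case: x => [[]|]. Qed.

(** As [h] only permutes each run, its output is again a run. The letters [upper] therefore delimit
    the same blocks in the image, and [h'] undoes [h] block by block. *)
Lemma runmapK h h' : cancel h h' -> (forall r, perm_eq (h r) r) ->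
  cancel (runmap h [::]) (runmap h' [::]).
Proof.
move=> hK hP w.
have run_h r : is_run r -> is_run (h r) by rewrite /is_run (perm_mem (hP r)).
suff H : forall r w, is_run r -> runmap h' [::] (runmap h r w) = r ++ w by exact: H.
apply: run_ind => [r rA | r {}w rA /= IH | r x {}w xA rA IH].
- by rewrite runmap_run ?run_h // hK cats0.
- by rewrite runmap_cat ?run_h // hK IH.
- by rewrite runmap_cons // IH cat_rcons.
Qed.

Lemma perm_runmap h r w : (forall r, perm_eq (h r) r) -> is_run r ->
  perm_eq (runmap h r w) (r ++ w).
Proof.
move=> hP; move: r w; apply: run_ind => [r rA | r w rA /= IH | r x w xA rA IH].
- by rewrite cats0; exact: hP.
- by apply: perm_cat; [exact: hP | rewrite perm_cons].
- by rewrite runmap_cons // -cat_rcons.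
Qed.

(* Keeps the [eqType] instances hidden in [count_mem] away from [lia]. *)
Definition occ x w : nat := count_mem x w.

(** [d] is the surplus of [upper] over [lower] among the letters already read. *)
Fixpoint ballot_from (d : nat) w :=
  match w with
  | [::] => true
  | Some true :: w' => ballot_from d.+1 w'
  | Some false :: w' => (0 < d) && ballot_from d.-1 w'
  | None :: w' => ballot_from d w'
  end.

Lemma ballot_fromP d w :
  reflect (forall i, occ lower (take i w) <= d + occ upper (take i w))
          (ballot_from d w).
Proof.
rewrite /occ; elim: w d => [|x w IH] d; first by apply: ReflectT.
apply: (iffP idP) => [Hb [|i] //|Hc].
- case: x Hb => [[]|] /=; rewrite ?add0n ?add1n ?addnS.
  + by move/IH; apply.
  + by case: d => [|d] //= /IH Hb; exact: Hb.
  + by move/IH; apply.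
- case: x Hc => [[]|] /= Hc.
  + by apply/IH => i; move: (Hc i.+1); rewrite /= add0n add1n addnS.
  + move: (Hc 1); rewrite /= take0 /= addn0; case: d Hc => [|d] Hc //= _.
    by apply/IH => i; move: (Hc i.+1); rewrite /= add0n add1n.
  + by apply/IH => i; exact: (Hc i.+1).
Qed.

(** Along a run the surplus never grows, so it is enough to test it at the end of the run. *)
Lemma ballot_from_run d r w : is_run r ->
  ballot_from d (r ++ w) =
  (occ lower r <= d) && ballot_from (d - occ lower r) w.
Proof.
rewrite /occ; elim: r d => [|x r IH] d; first by rewrite subn0.
rewrite is_run_cons => /andP[xA rA].
case: x xA => [[]|] //= _; rewrite IH //=.
by case: d => [|d] //=; rewrite add1n subSS.
Qed.

(** By [ballot_from_run], a run matters only through its number of letters [lower], which a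
    permutation keeps. *)
Lemma ballot_runmap h d r w : (forall r, perm_eq (h r) r) -> is_run r ->
  ballot_from d (runmap h r w) = ballot_from d (r ++ w).
Proof.
move=> hP.
have run_h s : is_run s -> is_run (h s) by rewrite /is_run (perm_mem (hP s)).
have cnt s : occ lower (h s) = occ lower s by exact/permP/hP.
move=> rA; move: r w rA d.
apply: run_ind => [r rA | r w rA /= IH | r x w xA rA IH] d.
- by rewrite /= cats0 -[h r]cats0 -{2}[r]cats0 !ballot_from_run ?run_h // cnt.
- by rewrite !ballot_from_run ?run_h // cnt /= IH.
- by rewrite runmap_cons // -cat_rcons.
Qed.

(* Descents between consecutive letters, in a row-increasing and in a standard
   tableau respectively. *)
Definition rdesc x y := (x != lower) && (y != upper).
Definition sdesc x y := (y == both) || ((x == upper) && (y == lower)).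

(** For a run made of [s] followed by [x], both sides equal [true :: map (pred1 both) s]. On the
    left each letter of [s] is compared with its successor and decides by itself; on the right [x]
    comes first and each letter of [s] is compared with its predecessor, again deciding by
    itself. *)
Lemma rdesc_rotr r : is_run r ->
  pairmap rdesc upper r = pairmap sdesc upper (rotr 1 r).
Proof.
case/lastP: r => [|s x] // ; rewrite is_run_rcons rotr1_rcons => /andP[xA sA].
have Hl y : y != upper -> pairmap rdesc y (rcons s x) = map (pred1 both) (y :: s).
  elim: s y sA => [|z s IH] y /=.
    by move=> _; case: y => [[]|] //; case: x xA => [[]|].
  rewrite is_run_cons => /andP[zA sA] yA /=; rewrite IH // /=.
  by case: y yA => [[]|] //; case: z zA => [[]|].
have Hr : forall y, y != upper -> pairmap sdesc y s = map (pred1 both) s.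
  elim: s sA {Hl} => [|z s IH] //=; rewrite is_run_cons => /andP[zA sA] y yA /=.
  by rewrite IH // /sdesc (negbTE yA) orbF.
have upS z : z != upper -> sdesc upper z by case: z => [[]|].
have upR z : z != upper -> rdesc upper z by case: z => [[]|].
rewrite /= Hr // upS //.
case: s sA Hl {Hr} => [|z s] /=; first by rewrite upR.
by rewrite is_run_cons => /andP[zA _] /(_ z zA)[_ ->]; rewrite upR.
Qed.

(* Starting from a fictitious letter [upper] shifts the list so that its entry of
   index v > 0 compares the letters of v and v.+1. *)
Lemma rdesc_runmap w :
  pairmap rdesc upper w = pairmap sdesc upper (runmap (rotr 1) [::] w).
Proof.
have run_rotr r : is_run (rotr 1 r) = is_run r by rewrite /is_run mem_rotr.
suff H r v : is_run r -> pairmap rdesc upper (r ++ v)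
    = pairmap sdesc upper (runmap (rotr 1) r v) by exact: (H [::]).
move: r v; apply: run_ind => [r rA | r v rA /= IH | r x v xA rA IH].
- by rewrite cats0 rdesc_rotr.
- rewrite pairmap_cat (pairmap_cat sdesc _ (rotr 1 r)) /= rdesc_rotr // IH.
  (* The letter before [upper] may differ on the two sides, but under either rule no letter followed
     by [upper] gives a descent. *)
  by rewrite /rdesc /sdesc /= !andbF.
- by rewrite runmap_cons // -cat_rcons.
Qed.

(** * Increasing sequences and positions of letters *)

Lemma nth_le_count (s : seq nat) j v : sorted ltn s -> j < size s ->
  (nth 0 s j <= v) = (j < count (leq^~ v) s).
Proof.
elim: s j => [|x s IH] //= j xs.
have := order_path_min ltn_trans xs => /allP xmin.
have [xv|vx] := leqP x v.
  case: j => [|j] //=; rewrite ltnS add1n ltnS => js.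
  by rewrite IH // (path_sorted xs).
have -> : count (leq^~ v) s = 0.
  apply/eqP; rewrite -leqn0 leqNgt -has_count.
  by apply/hasPn => y /xmin xy; rewrite -ltnNge (ltn_trans vx).
case: j => [|j] /= js; first by rewrite leqNgt vx.
by apply/negbTE; rewrite -ltnNge (ltn_trans vx) // xmin // mem_nth.
Qed.

(** Turns a comparison of two rows column by column into a comparison of counts, which become prefix
    counts of a word by [count_positions]. *)
Lemma nth_leq_count (a b : seq nat) :
    sorted ltn a -> sorted ltn b -> size b <= size a ->
  (forall j, j < size b -> nth 0 a j <= nth 0 b j) <->
  (forall v, count (leq^~ v) b <= count (leq^~ v) a).
Proof.
move=> sa sb ba; split=> [ab v | ab j jb].
  rewrite leqNgt; apply/negP => lt_ab.
  (* The offending index is the number of entries of [a] at most [v]: there [b] is at most [v],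
     hence so is [a], which gives one entry too many. *)
  have jb := leq_trans lt_ab (count_size _ _).
  have := lt_ab; rewrite -nth_le_count // => /(leq_trans (ab _ jb)).
  by rewrite nth_le_count ?ltnn // (leq_trans jb).
have ja := leq_trans jb ba.
by rewrite nth_le_count // (leq_trans _ (ab _)) // -nth_le_count.
Qed.

(** Tableau values start at 1 and indices of letters at 0, so value [i] is described by the letter
    of index [i.-1]. *)
Definition positions (p : pred letter) w :=
  [seq i <- iota 1 (size w) | p (nth both w i.-1)].

Lemma positions_sorted p w : sorted ltn (positions p w).
Proof. exact/sorted_filter/iota_ltn_sorted/ltn_trans. Qed.

Lemma mem_positions p w v :
  (v \in positions p w) = (0 < v <= size w) && p (nth both w v.-1).
Proof. by rewrite mem_filter mem_iota add1n ltnS andbC. Qed.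

Lemma positions_rcons p w x :
  positions p (rcons w x) = positions p w ++ (if p x then [:: (size w).+1] else [::]).
Proof.
rewrite /positions size_rcons -{1}[(size w).+1]addn1 iotaD filter_cat /= add1n nth_rcons ltnn eqxx.
congr (_ ++ _); apply: eq_in_filter => i; rewrite mem_iota add1n ltnS => /andP[i0 iw].
by rewrite nth_rcons prednK // iw.
Qed.

Lemma count_positions p w v :
  count (leq^~ v) (positions p w) = count p (take v w).
Proof.
elim/last_ind: w => [|w x IH] //.
rewrite positions_rcons count_cat IH; have [vw|wv] := leqP v (size w).
  rewrite -cats1 takel_cat //; case: (p x) => //=; last by rewrite addn0.
  by rewrite ltnNge vw !addn0.
rewrite !take_oversize ?size_rcons ?(ltnW wv) // -cats1 count_cat /=.
by case: (p x) => //=; rewrite wv.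
Qed.

Lemma size_positions p w : size (positions p w) = count p w.
Proof.
rewrite -[in RHS](take_size w) -count_positions; symmetry; apply/eqP.
by rewrite -all_count; apply/allP => i; rewrite mem_positions => /andP[/andP[]].
Qed.

Lemma positions_eq p w (s : seq nat) :
  sorted ltn s -> positions p w =i s -> positions p w = s.
Proof. exact/irr_sorted_eq/positions_sorted/ltnn/ltn_trans. Qed.

(** * Fillings and their rows *)

Section Rows.

Variables la mu : seq nat.
Implicit Type T : filling la mu.

(** The default 0 outside the shape gives access by coordinates without a proof of membership. *)
Definition entry T i j : nat := if insub (i, j) is Some b then T b else 0.

Definition row T i : seq nat :=
  [seq entry T i j | j <- iota (nth 0 mu i) (nth 0 la i - nth 0 mu i)].

Definition fill (g : nat -> nat -> nat) : filling la mu :=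
  [ffun b => g (box_row b) (box_col b)].

Lemma mem_boxes i j : ((i, j) \in boxes la mu) = (nth 0 mu i <= j < nth 0 la i).
Proof.
apply/idP/idP => [/allpairsPdep[i' [j' [_ ]]]|/andP[ij ji]].
  by rewrite mem_iota => Hj [-> ->]; lia.
apply/allpairsPdep; exists i, j; rewrite !mem_iota add0n /=; split=> //; last lia.
by rewrite ltnNge; apply/negP => /(nth_default 0) E; rewrite E in ji.
Qed.

Lemma entryE T (b : box la mu) : entry T (box_row b) (box_col b) = T b.
Proof. by rewrite /entry -surjective_pairing -[ssval b]/(val b) valK. Qed.

Lemma boxP (b : box la mu) : (box_row b, box_col b) \in boxes la mu.
Proof. by rewrite -surjective_pairing; exact: (valP b). Qed.

Lemma ex_box i j : (i, j) \in boxes la mu ->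
  exists b : box la mu, box_row b = i /\ box_col b = j.
Proof. by move=> ij; exists (SeqSub ij). Qed.

Lemma entry_fill g i j : (i, j) \in boxes la mu -> entry (fill g) i j = g i j.
Proof. by case/ex_box => b [<- <-]; rewrite entryE ffunE. Qed.

Lemma filling_eq T T' :
  (forall i j, (i, j) \in boxes la mu -> entry T i j = entry T' i j) -> T = T'.
Proof. by move=> H; apply/ffunP => b; rewrite -!entryE H ?boxP. Qed.

Lemma size_row T i : size (row T i) = nth 0 la i - nth 0 mu i.
Proof. by rewrite size_map size_iota. Qed.

Lemma nth_row T i j : nth 0 mu i <= j < nth 0 la i ->
  nth 0 (row T i) (j - nth 0 mu i) = entry T i j.
Proof.
by move=> ij; rewrite (nth_map 0) ?size_iota ?nth_iota ?subnKC //; lia.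
Qed.

Lemma row_strictP T : reflect (forall i, sorted ltn (row T i)) (row_strict T).
Proof.
apply: (iffP forallP) => [H i | H b].
  apply/(sortedP 0) => j; rewrite size_row => jlt.
  have E l : l < nth 0 la i - nth 0 mu i ->
      nth 0 (row T i) l = entry T i (nth 0 mu i + l) /\ (i, nth 0 mu i + l) \in boxes la mu.
    by move=> ll; rewrite mem_boxes -nth_row ?addKn; last lia; split => //; lia.
  have [-> /ex_box[b [br bc]]] := E _ jlt.
  have [-> /ex_box[c [cr cc]]] := E _ (ltnW jlt).
  rewrite -bc -cc -{1}cr -br !entryE.
  move/forallP: (H c) => /(_ b) /implyP; apply.
  by rewrite cr br bc cc eqxx /= ltn_add2l.
apply/forallP => c; apply/implyP => /andP[/eqP rr bc].
move: (boxP b) (boxP c); rewrite !mem_boxes -(entryE T b) -(entryE T c) -rr => hb hc.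
rewrite -!nth_row //; apply: (sorted_ltn_nth ltn_trans _ (H _)); rewrite ?inE ?size_row; lia.
Qed.

Lemma mem_row T i v :
  reflect (exists2 b : box la mu, box_row b = i & T b = v) (v \in row T i).
Proof.
apply: (iffP mapP) => [[j] | [b <- <-]].
  rewrite mem_iota => ij ->; have /ex_box[b [<- <-]] : (i, j) \in boxes la mu.
    by rewrite mem_boxes; lia.
  by exists b; rewrite ?entryE.
exists (box_col b); last by rewrite entryE.
by move: (boxP b); rewrite mem_boxes mem_iota; lia.
Qed.

Lemma descentP T v :
  reflect (exists i i', [/\ i < i', v \in row T i & v.+1 \in row T i'])
          (is_descent T v).
Proof.
apply: (iffP existsP) => [[b /existsP[c /and3P[/eqP bv /eqP cv bc]]]|].
  by exists (box_row b), (box_row c); split=> //; apply/mem_row; [exists b|exists c].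
move=> [i [i' [ii' /mem_row[b bi bv] /mem_row[c ci cv]]]].
by exists b; apply/existsP; exists c; rewrite bv cv bi ci !eqxx.
Qed.

Lemma boxes_uniq : uniq (boxes la mu).
Proof.
apply: allpairs_uniq_dep => [|i _|[i j] [i' j'] _ _ [-> ->] //]; exact: iota_uniq.
Qed.

Lemma codom_rows T :
  perm_eq (codom T) (flatten [seq row T i | i <- iota 0 (size la)]).
Proof.
rewrite codomE (_ : flatten _ = [seq entry T p.1 p.2 | p <- boxes la mu]); last first.
  by rewrite map_allpairs.
(* The enumeration of the finite type and the list [boxes] have the same members without repetition,
   but possibly in a different order. *)
have -> : [seq T b | b <- enum {: box la mu}] =
          [seq entry T p.1 p.2 | p <- [seq val b | b <- enum {: box la mu}]].
  by rewrite -[RHS]map_comp; apply: eq_map => b /=; rewrite -entryE.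
apply/perm_map/uniq_perm => [||p]; rewrite ?boxes_uniq //.
  by rewrite (map_inj_uniq val_inj) enum_uniq.
apply/mapP/idP => [[b _ ->]|pb]; first exact: valP.
by exists (SeqSub pb); rewrite ?mem_enum.
Qed.

Lemma size_boxes : size (boxes la mu) = sumn [seq nth 0 la i - nth 0 mu i | i <- iota 0 (size la)].
Proof.
by rewrite size_allpairs_dep; congr sumn; apply: eq_map => i; rewrite size_iota.
Qed.

Lemma max_entryE T N : codom T =i iota 1 N -> max_entry T = N.
Proof.
move=> TN; apply/eqP; rewrite eqn_leq; apply/andP; split.
  by apply/bigmax_leqP => b _; have := codom_f T b; rewrite TN mem_iota; lia.
case: N TN => // N TN; have : N.+1 \in codom T by rewrite TN mem_iota; lia.
by case/codomP => b ->; exact: leq_bigmax.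
Qed.

Lemma codom_entries_initial T : entries_initial T -> codom T =i iota 1 (max_entry T).
Proof.
case/andP=> /forallP T0 /allP TN v; apply/idP/idP => [/codomP[b ->]|/TN //].
by rewrite mem_iota T0 add1n ltnS leq_bigmax.
Qed.

Lemma entries_initial_iota T N : codom T =i iota 1 N -> entries_initial T.
Proof.
move=> TN; rewrite /entries_initial (max_entryE TN); apply/andP; split.
  by apply/forallP => b; have := codom_f T b; rewrite TN mem_iota; lia.
by apply/allP => v; rewrite TN.
Qed.

End Rows.

Arguments fill {la mu}.

Lemma row_fill la mu g i : row (fill g : filling la mu) i =
  [seq g i j | j <- iota (nth 0 mu i) (nth 0 la i - nth 0 mu i)].
Proof.
apply/eq_in_map => j; rewrite mem_iota => ij.
by rewrite entry_fill // mem_boxes; lia.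
Qed.

(** * Ballot words and the positions of their letters *)

Lemma nth_pairmap_upper (d : letter -> letter -> bool) w v :
  nth false (pairmap d upper w) v.+1 =
  (v.+1 < size w) && d (nth both w v) (nth both w v.+1).
Proof.
have [vw|wv] := ltnP; first by rewrite (nth_pairmap both).
by rewrite nth_default // size_pairmap.
Qed.

Lemma count_not_lower w :
  count (predC1 lower) w = occ upper w + occ both w.
Proof. by rewrite /occ; elim: w => //= x w ->; case: x => [[]|] /=; lia. Qed.

Lemma count_not_upper w :
  count (predC1 upper) w = occ lower w + occ both w.
Proof. by rewrite /occ; elim: w => //= x w ->; case: x => [[]|] /=; lia. Qed.

Lemma size_letters w :
  size w = occ upper w + occ lower w + occ both w.
Proof. by rewrite /occ; elim: w => //= x w ->; case: x => [[]|] /=; lia. Qed.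

(** A letter [both] contributes to the two sequences alike and cancels in the prefix counts. The
    bound on [occ] makes the lower sequence no longer than the upper one. *)
Lemma ballot_positions w :
    occ lower w <= occ upper w ->
  (forall j, j < count (predC1 upper) w ->
     nth 0 (positions (predC1 lower) w) j <= nth 0 (positions (predC1 upper) w) j) <->
  ballot_from 0 w.
Proof.
move=> lw; rewrite -(size_positions (predC1 upper)).
rewrite nth_leq_count ?positions_sorted //; last first.
  by rewrite !size_positions count_not_lower count_not_upper leq_add2r.
split=> [H|/ballot_fromP H v].
  apply/ballot_fromP => v; move: (H v); rewrite !count_positions.
  by rewrite count_not_lower count_not_upper leq_add2r.
by rewrite !count_positions count_not_lower count_not_upper leq_add2r; exact: H.
Qed.

Lemma ballot_positions1 w :
    occ lower w <= occ upper w ->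
  (forall j, j < occ lower w ->
     nth 0 (positions (pred1 upper) w) j < nth 0 (positions (pred1 lower) w) j) <->
  ballot_from 0 w.
Proof.
move=> lw; rewrite -[occ lower w](size_positions (pred1 lower)).
transitivity (forall j, j < size (positions (pred1 lower) w) ->
     nth 0 (positions (pred1 upper) w) j <= nth 0 (positions (pred1 lower) w) j).
  split=> H j jw; first exact/ltnW/H.
  (* Equality would put both letters [upper] and [lower] at one position, so weak and strict
     comparison agree. *)
  rewrite ltn_neqAle H // andbT; apply/eqP => E.
  have := mem_nth 0 jw; rewrite -E.
  have : nth 0 (positions (pred1 upper) w) j \in positions (pred1 upper) w.
    by rewrite mem_nth // (leq_trans jw) // !size_positions.
  by rewrite !mem_positions => /andP[_ /eqP ->] /andP[_].
rewrite nth_leq_count ?positions_sorted ?size_positions //.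
split=> [H|/ballot_fromP H v].
  by apply/ballot_fromP => v; move: (H v); rewrite !count_positions.
by rewrite !count_positions; exact: H.
Qed.

(** There are [n - k], [m - k] and [k] letters of the three kinds. The additive form leaves no word
    when [k > m]. *)
Definition ballot_word n m k w :=
  [&& occ upper w + k == n, occ lower w + k == m,
      occ both w == k & ballot_from 0 w].

Lemma ballot_word_runmap h n m k w : (forall r, perm_eq (h r) r) ->
  ballot_word n m k w -> ballot_word n m k (runmap h [::] w).
Proof.
move=> hP; rewrite /ballot_word ballot_runmap //.
have /permP E : perm_eq (runmap h [::] w) w by apply: perm_runmap.
by rewrite /occ !E.
Qed.

Lemma positions_mkseq p (f : nat -> letter) N (s : seq nat) : sorted ltn s ->
  (forall v, (v \in s) = (0 < v <= N) && p (f v.-1)) -> positions p (mkseq f N) = s.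
Proof.
move=> ss sP; apply: positions_eq => // v; rewrite mem_positions sP size_mkseq.
by case: v => [|v] //=; have [vN|//] := ltnP v N; rewrite nth_mkseq.
Qed.

(** * Row-increasing tableaux as ballot words *)

Section RowIncreasing.

Variables n m k : nat.
Hypotheses (m_gt0 : 0 < m) (le_mn : m <= n).

Implicit Type T : filling [:: n; m] [::].

Definition rinc_fill w : filling [:: n; m] [::] :=
  fill (fun i j => nth 0 (positions (predC1 (if i is 0 then lower else upper)) w) j).

Definition rinc_word T :=
  mkseq (fun i => if i.+1 \in row T 0 then if i.+1 \in row T 1 then both else upper
                  else lower) (max_entry T).

Lemma is_RIncP T : is_RInc k T <->
  [/\ sorted ltn (row T 0), sorted ltn (row T 1),
      forall j, j < m -> nth 0 (row T 0) j <= nth 0 (row T 1) j,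
      row T 0 ++ row T 1 =i iota 1 (max_entry T) & max_entry T + k = n + m].
Proof.
have shape : is_skew_shape [:: n; m] [::].
  by rewrite /is_skew_shape /is_partition /= !inE andbT; lia.
have codE : codom T =i row T 0 ++ row T 1.
  by move=> v; rewrite (perm_mem (codom_rows T)) /= cats0.
have rowE i j : (i, j) \in boxes [:: n; m] [::] -> nth 0 (row T i) j = entry T i j.
  by rewrite mem_boxes => ij; rewrite -nth_row // nth_nil subn0.
rewrite /is_RInc shape /row_increasing size_boxes /= !subn0 addn0.
split=> [/andP[/and3P[/row_strictP rs cw /codom_entries_initial ei] /eqP mx]|[s0 s1 cw ei ->]].
  split=> // [j jm|v]; last by rewrite -codE.
  have [/ex_box[b [br bc]] /ex_box[c [cr cc]]] :
    (0, j) \in boxes [:: n; m] [::] /\ (1, j) \in boxes [:: n; m] [::].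
    by rewrite !mem_boxes /=; lia.
  rewrite !rowE ?mem_boxes /=; try lia.
  have -> : entry T 0 j = T b by rewrite -br -bc entryE.
  have -> : entry T 1 j = T c by rewrite -cr -cc entryE.
  move/forallP: cw => /(_ b) /forallP/(_ c) /implyP; apply.
  by rewrite br bc cr cc eqxx.
rewrite eqxx andbT; apply/and3P; split.
- apply/row_strictP => -[|[|i]] //.
  by rewrite (size0nil (s := row T i.+2)) // size_row /= nth_nil.
- apply/forallP => b; apply/forallP => c; apply/implyP => /andP[/eqP bc br].
  move: (boxP b) (boxP c) => hb hc.
  rewrite -!entryE -!rowE //; move: hb hc; rewrite !mem_boxes -bc.
  case: (box_row b) br => [|[|i]]; case: (box_row c) => [|[|i']] //=;
    rewrite ?nth_nil //= => _ _ /cw //.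
- by apply: (@entries_initial_iota _ _ _ (max_entry T)) => v; rewrite codE.
Qed.

Lemma rinc_word_rows T : is_RInc k T ->
  positions (predC1 lower) (rinc_word T) = row T 0 /\
  positions (predC1 upper) (rinc_word T) = row T 1.
Proof.
case/is_RIncP=> s0 s1 _ TN _.
(* The entries fill an initial segment, so a value up to the maximum that is missing from row 0 is
   in row 1 and rightly gets [lower]. *)
have rng v : (v \in row T 0) || (v \in row T 1) = (0 < v <= max_entry T).
  by rewrite -mem_cat TN mem_iota add1n ltnS.
split; (apply: positions_mkseq; first by []) => v; rewrite -rng;
  case: v => [|v] /=; try by case: (_ \in row T 0); case: (_ \in row T 1).
- by have /norP[/negbTE -> /negbTE ->] := negbT (rng 0).
- by have /norP[/negbTE -> /negbTE ->] := negbT (rng 0).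
Qed.

(** The two row lengths and the maximal entry give three linear equations that determine the number
    of letters of each kind. *)
Lemma rinc_word_ballot T : is_RInc k T -> ballot_word n m k (rinc_word T).
Proof.
move=> hT; have [E0 E1] := rinc_word_rows hT.
case/is_RIncP: hT => _ _ cw _ mx.
have := size_letters (rinc_word T); rewrite size_mkseq.
have := size_positions (predC1 lower) (rinc_word T).
have := size_positions (predC1 upper) (rinc_word T).
rewrite E0 E1 !size_row count_not_lower count_not_upper /= !subn0 => em en eN.
have le_lu : occ lower (rinc_word T) <= occ upper (rinc_word T) by lia.
rewrite /ballot_word; apply/and4P; split; try by apply/eqP; lia.
by apply/(ballot_positions le_lu) => j; rewrite E0 E1 count_not_upper -em => /cw.
Qed.

Lemma rinc_fill_rows w : ballot_word n m k w ->
  row (rinc_fill w) 0 = positions (predC1 lower) w /\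
  row (rinc_fill w) 1 = positions (predC1 upper) w.
Proof.
case/and4P=> /eqP en /eqP em /eqP ek _.
rewrite !row_fill /= !subn0 -{1}en -{1}em -ek.
by rewrite -count_not_lower -count_not_upper -!size_positions !map_nth_iota0 ?take_size.
Qed.

Lemma max_rinc_fill w : ballot_word n m k w -> max_entry (rinc_fill w) = size w.
Proof.
move=> hw; have [E0 E1] := rinc_fill_rows hw; apply: max_entryE => v.
rewrite (perm_mem (codom_rows _)) /= cats0 E0 E1 mem_cat !mem_positions mem_iota.
by case: (nth _ w _) => [[]|]; rewrite add1n ltnS /= ?andbT ?andbF ?orbF ?orbb.
Qed.

Lemma rinc_fill_RInc w : ballot_word n m k w -> is_RInc k (rinc_fill w).
Proof.
move=> hw; have [E0 E1] := rinc_fill_rows hw; have mx := max_rinc_fill hw.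
apply/is_RIncP; rewrite mx E0 E1 !positions_sorted; split=> //.
- case/and4P: hw => /eqP en /eqP em /eqP ek /ballot_positions H j jm.
  by apply: H; rewrite ?count_not_upper; lia.
- move=> v; rewrite mem_cat !mem_positions mem_iota.
  by case: (nth _ w _) => [[]|]; rewrite add1n ltnS /= ?andbT ?andbF ?orbF ?orbb.
- by case/and4P: hw => /eqP en /eqP em /eqP ek _; rewrite size_letters; lia.
Qed.

Lemma rinc_fillK w : ballot_word n m k w -> rinc_word (rinc_fill w) = w.
Proof.
move=> hw; have [E0 E1] := rinc_fill_rows hw; have mx := max_rinc_fill hw.
apply: (@eq_from_nth _ both); rewrite size_mkseq mx // => i iw.
rewrite /rinc_word nth_mkseq ?mx // E0 E1 !mem_positions /= iw /=.
by case: (nth _ w _) => [[]|].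
Qed.

Lemma rinc_wordK T : is_RInc k T -> rinc_fill (rinc_word T) = T.
Proof.
move=> hT; have [E0 E1] := rinc_word_rows hT; apply: filling_eq => i j ij.
rewrite entry_fill //; move: (ij); rewrite mem_boxes => /nth_row <-.
rewrite nth_nil subn0.
case: i ij => [|[|i]] ij; rewrite ?E0 ?E1 //.
by move: ij; rewrite mem_boxes /= nth_nil ltn0.
Qed.

Lemma rinc_descent T v : is_RInc k T ->
  is_descent T v = (0 < v) && nth false (pairmap rdesc upper (rinc_word T)) v.
Proof.
move=> hT; have [E0 E1] := rinc_word_rows hT.
(* With only two nonempty rows, a descent must go from row 0 to row 1. *)
have -> : is_descent T v = (v \in row T 0) && (v.+1 \in row T 1).
  apply/descentP/andP => [[i [i' [ii' vi vi']]]|[v0 v1]]; last by exists 0, 1.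
  have r0 l : row T l.+2 = [::] by apply: size0nil; rewrite size_row /= nth_nil.
  case: i i' ii' vi vi' => [|[|i]] [|[|i']] //; by rewrite !r0.
rewrite -E0 -E1 !mem_positions; case: v => [|v] //=.
by rewrite nth_pairmap_upper /rdesc /=; 
  have [/ltnW ->|_] := ltnP v.+1; rewrite ?andbF.
Qed.

End RowIncreasing.

Lemma perm_positions w :
  perm_eq (positions (pred1 upper) w ++ positions (pred1 lower) w ++
           positions (pred1 both) w) (iota 1 (size w)).
Proof.
apply/permP => P; rewrite !count_cat !count_filter.
elim: (iota _ _) => //= i s <-; case: (nth both w i.-1) => [[]|] /=; rewrite ?andbT ?andbF; lia.
Qed.

(** * Standard tableaux as ballot words *)

Section Standard.

Variables n m k : nat.
Hypotheses (m_gt0 : 0 < m) (le_mn : m <= n).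

Implicit Type T : filling (outer_shape n m k) [:: 1; 1].

(** Rows 0 and 1 start in column 1 because of the inner shape, whence [j.-1]. Each further row is a
    single box in column 0, so the row number selects the entry. *)
Definition syt_fill w : filling (outer_shape n m k) [:: 1; 1] :=
  fill (fun i j => match i with
                   | 0 => nth 0 (positions (pred1 upper) w) j.-1
                   | 1 => nth 0 (positions (pred1 lower) w) j.-1
                   | i'.+2 => nth 0 (positions (pred1 both) w) i'
                   end).

(** The boxes of the first column, read downwards, act as a third row: they hold the values marked
    [both]. *)
Definition col0 T : seq nat := [seq entry T i 0 | i <- iota 2 k].

Definition syt_word T :=
  mkseq (fun i => if i.+1 \in row T 0 then upper
                  else if i.+1 \in row T 1 then lower else both) (max_entry T).

Lemma nth_outer i : nth 0 (outer_shape n m k) i.+2 = (i < k).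
Proof. by rewrite /= nth_nseq; case: ltnP. Qed.

Lemma nth_inner i : nth 0 [:: 1; 1] i.+2 = 0.
Proof. by rewrite /= nth_nil. Qed.

Lemma row_col0 T i : row T i.+2 = if i < k then [:: entry T i.+2 0] else [::].
Proof. by rewrite /row nth_outer nth_inner; case: ltnP. Qed.

Lemma mem_col0 T v :
  reflect (exists2 i, i < k & v = entry T i.+2 0) (v \in col0 T).
Proof.
apply: (iffP mapP) => [[[|[|i]]]|[i ik ->]].
- by rewrite mem_iota.
- by rewrite mem_iota.
- by rewrite mem_iota => ik ->; exists i.
- by exists i.+2; rewrite // mem_iota.
Qed.

Lemma codom_syt T : perm_eq (codom T) (row T 0 ++ row T 1 ++ col0 T).
Proof.
rewrite (perm_trans (codom_rows T)) //= size_nseq !perm_cat2l.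
suff -> : [seq row T i | i <- iota 2 k] = [seq [:: entry T i 0] | i <- iota 2 k].
  by rewrite flatten_map1.
apply/eq_in_map => -[|[|i]]; rewrite mem_iota // => ik.
by rewrite row_col0; have -> : i < k by lia.
Qed.

(** For [k > m] the second part truncates to 0, which a partition excludes; for [k <= m] the parts
    are positive and weakly decreasing. *)
Lemma is_skew_outer : is_skew_shape (outer_shape n m k) [:: 1; 1] = (k <= m).
Proof.
rewrite /is_skew_shape /is_partition /= !inE.
have -> : path geq (m.+1 - k) (nseq k 1) = (k == 0) || (k <= m).
  have P1 l : path geq 1 (nseq l 1) by elim: l.
  by case: (k) => //= l; rewrite P1; lia.
have -> : 0 \in nseq k 1 = false by rewrite mem_nseq andbF.
lia.
Qed.

(** The boxes of column 0 share neither row nor column with those of rows 0 and 1, so the conditions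
    split into one set for the two rows and one for the column. *)
Lemma is_SYTP T : is_SYT T <->
  [/\ k <= m, sorted ltn (row T 0) /\ sorted ltn (row T 1), sorted ltn (col0 T),
      forall j, j < m - k -> nth 0 (row T 0) j < nth 0 (row T 1) j &
      perm_eq (row T 0 ++ row T 1 ++ col0 T) (iota 1 (n + m - k))].
Proof.
rewrite /is_SYT is_skew_outer (perm_sym _ (iota _ _)) (permPr (codom_syt T)).
rewrite (perm_sym (iota _ _)).
have [km|] := leqP k m; last by split=> // -[].
(* The count is [(n - k) + (m - k) + k]. *)
have -> : size (boxes (outer_shape n m k) [:: 1; 1]) = n + m - k.
  rewrite size_boxes /= size_nseq.
  have /eq_in_map -> : {in iota 2 k,
      (fun i => nth 0 (outer_shape n m k) i - nth 0 [:: 1; 1] i) =1 fun=> 1}.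
    move=> [|[|i]]; rewrite mem_iota // => ik.
    by rewrite nth_outer nth_inner; have -> : i < k by lia.
  by rewrite sumnE big_map sum1_size size_iota; lia.
have r0E j : (0, j) \in boxes (outer_shape n m k) [:: 1; 1] ->
    nth 0 (row T 0) j.-1 = entry T 0 j.
  by rewrite mem_boxes => /nth_row <-; rewrite subn1.
have r1E j : (1, j) \in boxes (outer_shape n m k) [:: 1; 1] ->
    nth 0 (row T 1) j.-1 = entry T 1 j.
  by rewrite mem_boxes => /nth_row <-; rewrite subn1.
split=> [/and4P[_ /row_strictP rs cs ->]|[_ [s0 s1] sc cs ->]].
  have lt_col i i' j : (i, j) \in boxes (outer_shape n m k) [:: 1; 1] ->
      (i', j) \in boxes (outer_shape n m k) [:: 1; 1] ->
      i < i' -> entry T i j < entry T i' j.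
    move=> /ex_box[b [<- <-]] /ex_box[c [<- cc]]; rewrite -{2}cc !entryE => bc.
    by move/forallP: cs => /(_ b) /forallP/(_ c) /implyP; apply; rewrite cc eqxx.
  split=> //.
    apply/(sortedP 0) => i; rewrite size_map size_iota => ik.
    rewrite !(nth_map 0) ?size_iota ?(ltnW ik) // !nth_iota ?(ltnW ik) //.
    by apply: lt_col; rewrite ?mem_boxes ?nth_outer ?nth_inner ?ik ?(ltnW ik) ?ltn_add2l.
  move=> j jm.
  have h0 : (0, j.+1) \in boxes (outer_shape n m k) [:: 1; 1].
    by rewrite mem_boxes /=; lia.
  have h1 : (1, j.+1) \in boxes (outer_shape n m k) [:: 1; 1].
    by rewrite mem_boxes /=; lia.
  by have := lt_col 0 1 _ h0 h1 isT; rewrite -r0E // -r1E.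
rewrite /= andbT; apply/andP; split.
  apply/row_strictP => -[|[|i]] //.
  by rewrite row_col0; case: ifP.
apply/forallP => b; apply/forallP => c; apply/implyP => /andP[/eqP bc br].
rewrite -!entryE; move: (boxP b) (boxP c) br; rewrite -bc.
move: (box_row b) (box_row c) (box_col b) => [|[|i]] [|[|i']] j // hb hc ii'.
- by rewrite -r0E // -r1E //; apply: cs; move: hb hc; rewrite !mem_boxes /=; lia.
(* A box in rows 0 or 1 has column at least 1, and one further down has column 0, so they cannot
   share a column. *)
- by move: hb hc; rewrite !mem_boxes nth_outer nth_inner /=; lia.
- by move: hb hc; rewrite !mem_boxes nth_outer nth_inner /=; lia.
move: hb hc; rewrite !mem_boxes !nth_outer !nth_inner /= => hb hc.
have ik : i < k by move: hb; case: (i < k) => //; lia.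
have ik' : i' < k by move: hc; case: (i' < k) => //; lia.
have -> : j = 0 by move: hb; rewrite ik; lia.
have := sorted_ltn_nth ltn_trans 0 sc i i'; rewrite !inE !size_map !size_iota.
move=> /(_ ik ik' ii').
by rewrite !(nth_map 0) ?size_iota // !nth_iota.
Qed.

Lemma max_syt T : is_SYT T -> max_entry T = n + m - k.
Proof.
case/is_SYTP=> _ _ _ _ pT; apply: max_entryE => v.
by rewrite (perm_mem (codom_syt T)) (perm_mem pT).
Qed.

Lemma syt_word_rows T : is_SYT T ->
  [/\ positions (pred1 upper) (syt_word T) = row T 0,
      positions (pred1 lower) (syt_word T) = row T 1 &
      positions (pred1 both) (syt_word T) = col0 T].
Proof.
move=> hT; have mx := max_syt hT; case/is_SYTP: hT => _ [s0 s1] s2 _ pT.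
have rng v : [|| v \in row T 0, v \in row T 1 | v \in col0 T] =
             (0 < v <= max_entry T).
  by rewrite -!mem_cat (perm_mem pT) mx mem_iota add1n ltnS.
(* Covering all values is not enough here: [syt_word] tests the rows in order, so the three
   sequences must also be disjoint. *)
have : uniq (row T 0 ++ row T 1 ++ col0 T) by rewrite (perm_uniq pT) iota_uniq.
rewrite !cat_uniq => /and3P[_ /hasPn d0 /and3P[_ /hasPn d1 _]].
have d01 v : v \in row T 1 -> v \notin row T 0.
  by move=> v1; apply: d0; rewrite mem_cat v1.
have d02 v : v \in col0 T -> v \notin row T 0.
  by move=> v1; apply: d0; rewrite mem_cat v1 orbT.
have zero := negbT (rng 0).
case/norP: zero => /negbTE z0 /norP[/negbTE z1 /negbTE z2].
by split; (apply: positions_mkseq; first by []) => -[|v];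
  rewrite ?z0 ?z1 ?z2 // -rng /=;
  move: (d01 v.+1) (d02 v.+1) (d1 v.+1);
  case: (v.+1 \in row T 0); case: (v.+1 \in row T 1); case: (v.+1 \in col0 T) => //=;
  do ?[by move=> /(_ isT)|by move=> _ /(_ isT)|by move=> _ _ /(_ isT)].
Qed.

Lemma syt_word_ballot T : is_SYT T -> ballot_word n m k (syt_word T).
Proof.
move=> hT; have [E0 E1 E2] := syt_word_rows hT.
case/is_SYTP: hT => km _ _ cs _.
have := size_positions (pred1 upper) (syt_word T).
have := size_positions (pred1 lower) (syt_word T).
have := size_positions (pred1 both) (syt_word T).
rewrite E0 E1 E2 !size_row size_map size_iota /= -!/(occ _ _) => ek em en.
have le_lu : occ lower (syt_word T) <= occ upper (syt_word T) by lia.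
rewrite /ballot_word; apply/and4P; split; try by apply/eqP; lia.
by apply/(ballot_positions1 le_lu) => j; rewrite E0 E1 -em => jm; apply: cs; lia.
Qed.

Lemma syt_fill_rows w : ballot_word n m k w ->
  [/\ row (syt_fill w) 0 = positions (pred1 upper) w,
      row (syt_fill w) 1 = positions (pred1 lower) w &
      col0 (syt_fill w) = positions (pred1 both) w].
Proof.
case/and4P=> /eqP en /eqP em /eqP ek _.
have E x : size (positions (pred1 x) w) = occ x w by rewrite size_positions.
have iota_pred (s : seq nat) : [seq nth 0 s j.-1 | j <- iota 1 (size s)] = s.
  by rewrite -[1]/(1 + 0) iotaDl -map_comp /= map_nth_iota0 ?take_size.
split.
- by rewrite row_fill /= (_ : _ - 1 = size (positions (pred1 upper) w)) // E; lia.
- by rewrite row_fill /= (_ : _ - 1 = size (positions (pred1 lower) w)) // E; lia.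
have -> : col0 (syt_fill w) = [seq nth 0 (positions (pred1 both) w) i.-2 | i <- iota 2 k].
  apply/eq_in_map => -[|[|i]]; rewrite mem_iota // => ik.
  by rewrite entry_fill // mem_boxes nth_outer nth_inner; have -> : i < k by lia.
rewrite -[2]/(2 + 0) iotaDl -map_comp /= -ek -E.
by rewrite map_nth_iota0 ?take_size.
Qed.

Lemma syt_fill_SYT w : ballot_word n m k w -> is_SYT (syt_fill w).
Proof.
move=> hw; have [E0 E1 E2] := syt_fill_rows hw.
case/and4P: hw => /eqP en /eqP em /eqP ek bw.
apply/is_SYTP; rewrite E0 E1 E2 !positions_sorted; split=> //; first lia.
  by move=> j jm; apply: (proj2 (ballot_positions1 _)) => //; lia.
have -> : n + m - k = size w by rewrite size_letters; lia.
exact: perm_positions.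
Qed.

Lemma syt_fillK w : ballot_word n m k w -> syt_word (syt_fill w) = w.
Proof.
move=> hw; have [E0 E1 E2] := syt_fill_rows hw.
have mx : max_entry (syt_fill w) = size w.
  rewrite max_syt ?syt_fill_SYT //.
  by case/and4P: hw => /eqP en /eqP em /eqP ek _; rewrite size_letters; lia.
apply: (@eq_from_nth _ both); rewrite size_mkseq mx // => i iw.
rewrite /syt_word nth_mkseq ?mx // E0 E1 !mem_positions /= iw /=.
by case: (nth _ w _) => [[]|].
Qed.

Lemma syt_wordK T : is_SYT T -> syt_fill (syt_word T) = T.
Proof.
move=> hT; have [E0 E1 E2] := syt_word_rows hT; apply: filling_eq => i j ij.
rewrite entry_fill //; move: (ij); rewrite mem_boxes => /nth_row <-.
case: i ij => [|[|i]] ij; rewrite ?E0 ?E1 ?subn1 //.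
move: ij; rewrite mem_boxes nth_outer nth_inner row_col0 E2 /= => ij.
have ik : i < k by move: ij; case: (i < k) => //; lia.
have -> : j = 0 by move: ij; rewrite ik; lia.
by rewrite ik (nth_map 0) ?size_iota // nth_iota.
Qed.

(** If [v.+1] is in column 0, then [v] is always above it, either in rows 0 and 1 or higher in the
    increasing column. Otherwise a descent requires [v] in row 0 and [v.+1] in row 1. *)
Lemma syt_descent T v : is_SYT T ->
  is_descent T v = (0 < v) && nth false (pairmap sdesc upper (syt_word T)) v.
Proof.
move=> hT; have [E0 E1 E2] := syt_word_rows hT.
have s2 : sorted ltn (col0 T) by case/is_SYTP: hT.
have -> : is_descent T v =
    ((v \in row T 0) && (v.+1 \in row T 1)) ||
    [|| v \in row T 0, v \in row T 1 | v \in col0 T] && (v.+1 \in col0 T).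
  have in_col0 u i : u \in row T i.+2 -> i < k /\ u = entry T i.+2 0.
    by rewrite row_col0; case: ifP => // _; rewrite inE => /eqP.
  have col0_row i : i < k -> entry T i.+2 0 \in row T i.+2.
    by move=> ik; rewrite row_col0 ik inE.
  apply/descentP/idP => [[i [i' [ii' vi vi']]]|].
    case: i i' ii' vi vi' => [|[|i]] [|[|i']] // ii' vi; first by rewrite vi => ->.
    - move=> /in_col0 [ik ->]; rewrite vi /=; apply/orP; right.
      by apply/mem_col0; exists i'.
    - move=> /in_col0 [ik ->]; rewrite vi /= orbT; apply/orP; right.
      by apply/mem_col0; exists i'.
    move/in_col0: vi => [ik ->] /in_col0 [ik' ->].
    apply/orP; right; apply/andP; split; last by apply/mem_col0; exists i'.
    by rewrite !orbA; apply/orP; right; apply/mem_col0; exists i.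
  case/orP=> [/andP[v0 v1]|/andP[/or3P[v0|v0|v0] /mem_col0[i' ik' Ev]]].
  - by exists 0, 1.
  - by exists 0, i'.+2; rewrite Ev col0_row.
  - by exists 1, i'.+2; rewrite Ev col0_row.
  case/mem_col0: v0 => i ik E; exists i.+2, i'.+2; rewrite Ev E !col0_row //; split=> //.
  (* If [v.+1] were not strictly below [v], monotonicity of the column would give [v.+1 <= v]. *)
  rewrite !ltnS ltnNge; apply/negP => le_i'i.
  have := sorted_leq_nth leq_trans leqnn 0 (sub_sorted (@ltnW) s2) i' i.
  rewrite !inE !size_map !size_iota !(nth_map 0) ?size_iota // !nth_iota // => /(_ ik' ik le_i'i).
  by rewrite -E -Ev ltnn.
rewrite -E0 -E1 -E2 !mem_positions; case: v => [|v] //=.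
rewrite nth_pairmap_upper /sdesc /=.
have [/ltnW ->|_] := ltnP v.+1; last by rewrite !andbF.
by case: (nth _ _ v) => [[]|] /=; case: (nth _ _ v.+1) => [[]|].
Qed.

End Standard.

(** * The bijection *)

Theorem theorem1p4 (n m k : nat) (hm : 1 <= m) (hnm : m <= n) :
  exists f : RInc k [:: n; m] [::] -> SYT (outer_shape n m k) [:: 1; 1],
    bijective f /\ forall T, maj (sval (f T)) = maj (sval T).
Proof.
have rotr_perm (r : seq letter) : perm_eq (rotr 1 r) r by rewrite perm_rotr.
have rot_perm (r : seq letter) : perm_eq (rot 1 r) r by rewrite perm_rot.
(* Encode, rotate every run by one step, decode; [G] rotates back. *)
pose F (T : filling [:: n; m] [::]) := syt_fill n m k (runmap (rotr 1) [::] (rinc_word T)).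
pose G (S : filling (outer_shape n m k) [:: 1; 1]) := rinc_fill n m (runmap (rot 1) [::] (syt_word S)).
have wF (T : RInc k [:: n; m] [::]) :
    ballot_word n m k (runmap (rotr 1) [::] (rinc_word (sval T))).
  exact/ballot_word_runmap/rinc_word_ballot/(svalP T).
have wG (S : SYT (outer_shape n m k) [:: 1; 1]) :
    ballot_word n m k (runmap (rot 1) [::] (syt_word (sval S))).
  exact/ballot_word_runmap/syt_word_ballot/(svalP S).
pose f (T : RInc k [:: n; m] [::]) : SYT (outer_shape n m k) [:: 1; 1] :=
  exist _ (F (sval T)) (syt_fill_SYT hm hnm (wF T)).
pose g (S : SYT (outer_shape n m k) [:: 1; 1]) : RInc k [:: n; m] [::] :=
  exist _ (G (sval S)) (rinc_fill_RInc hm hnm (wG S)).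
exists f; split.
  exists g => [T|S]; apply: val_inj => /=; rewrite /G /F.
    rewrite syt_fillK // runmapK //; last exact: rotrK.
    by rewrite (rinc_wordK hm hnm (svalP T)).
  rewrite (rinc_fillK (wG S)) runmapK //; last exact: rotK.
  by rewrite (syt_wordK hm hnm (svalP S)).
move=> T.
(* Both maxima are [n + m - k], so the two sums run over the same range and only the descent sets
   remain to be compared. *)
have E : max_entry (sval (f T)) = max_entry (sval T).
  rewrite (max_syt hm hnm (svalP (f T))).
  by have := svalP T => /(is_RIncP _ hm hnm) [_ _ _ _]; lia.
rewrite /maj E; apply: eq_bigl => i.
rewrite (syt_descent hm hnm _ (svalP (f T))) (rinc_descent hm hnm _ (svalP T)).
by rewrite rdesc_runmap /= /F syt_fillK.
Qed.
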